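(* Let $\mathcal W$ be a discrete memoryless channel from a finite set $\mathcal X$ to a finite set $\mathcal Y$. For every fixed integer $M\ge2$, $$\liminf_{n\to\infty}-\frac1n\log\epsilon^{\rm NS}(M,\mathcal W^{\times n})=U(\mathcal W).$$
   Context: For probability distributions $P,Q$ on a finite set, $D(P\|Q)=\sum_x P(x)\log\frac{P(x)}{Q(x)}$ (with $0\log(0/q)=0$, and $+\infty$ if $P\not\ll Q$). A discrete memoryless channel $\mathcal W$ from $\mathcal X$ to $\mathcal Y$ is a stochastic matrix $(\mathcal W(y|x))$; $\mathcal W^{\times n}(y^n|x^n)=\prod_{i}\mathcal W(y_i|x_i)$. The channel umlaut information is $U(\mathcal W)=\max_{P_X\in\mathcal P(\mathcal X)}\min_{Q_Y\in\mathcal P(\mathcal Y)}D(P_X\times Q_Y\|P_{XY})$ with $P_{XY}(x,y)=P_X(x)\mathcal W(y|x)$. An NS code for message set $[M]$ and channel $\mathcal W$ is a conditional distribution $\mathcal Z(x,\hat w\mid y,w)$ ($x\in\mathcal X$, $\hat w,w\in[M]$, $y\in\mathcal Y$) such that $\sum_x\mathcal Z(x,\hat w\mid y,w)$ does not depend on $w$ and $\sum_{\hat w}\mathcal Z(x,\hat w\mid y,w)$ does not depend on $y$. Its error probability (uniform messages) is $1-\frac1M\sum_{w}\sum_{x,y}\mathcal W(y|x)\mathcal Z(x,w\mid y,w)$; $\epsilon^{\rm NS}(M,\mathcal W)$ is the minimum over NS codes.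
   Formalization: The maximum over P_X defining U(W) is read as a supremum, since it need not be attained: for W(·|0)=(1,0), W(·|1)=(1/2,1/2) the values p log 2 (0<p<1) approach log 2, but the value at p=1 is 0. *)

(* Defs.v *)
From HB Require Import structures.
From mathcomp Require Import all_boot all_order all_algebra.
From mathcomp Require Import all_classical all_reals all_analysis.
Set Implicit Arguments. Unset Strict Implicit. Unset Printing Implicit Defensive.
Import Order.TTheory GRing.Theory Num.Theory.
Local Open Scope ring_scope.
Local Open Scope classical_set_scope.

Section Defs.
Variable R : realType.

Definition is_dist (T : finType) (P : T -> R) : Prop :=
  (forall t, 0 <= P t) /\ \sum_(t : T) P t = 1.

Definition is_channel (X Y : finType) (W : X -> Y -> R) : Prop :=
  forall x, is_dist (W x).

Definition kl_term (p q : R) : \bar R :=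
  if p == 0 then 0%E else if q == 0 then +oo%E else (p * ln (p / q))%:E.
Definition kl (T : finType) (P Q : T -> R) : \bar R :=
  (\sum_(t : T) kl_term (P t) (Q t))%E.

Definition umlaut (X Y : finType) (W : X -> Y -> R) : \bar R :=
  ereal_sup [set u | exists PX : X -> R, is_dist PX /\
    u = ereal_inf [set v | exists QY : Y -> R, is_dist QY /\
          v = kl (fun xy : X * Y => PX xy.1 * QY xy.2)
                 (fun xy : X * Y => PX xy.1 * W xy.1 xy.2)]].

Definition chan_pow (X Y : finType) (W : X -> Y -> R) (n : nat)
  : {ffun 'I_n -> X} -> {ffun 'I_n -> Y} -> R :=
  fun xn yn => \prod_(i < n) W (xn i) (yn i).

Definition is_NS_code (X Y : finType) (M : nat)
  (Z : X -> 'I_M -> Y -> 'I_M -> R) : Prop :=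
  [/\ (forall x wh y w, 0 <= Z x wh y w),
      (forall y w, \sum_(x : X) \sum_(wh : 'I_M) Z x wh y w = 1),
      (forall wh y w w', \sum_(x : X) Z x wh y w = \sum_(x : X) Z x wh y w') &
      (forall x y y' w, \sum_(wh : 'I_M) Z x wh y w = \sum_(wh : 'I_M) Z x wh y' w)].

Definition NS_error (X Y : finType) (M : nat) (W : X -> Y -> R)
  (Z : X -> 'I_M -> Y -> 'I_M -> R) : R :=
  1 - M%:R^-1 * \sum_(w : 'I_M) \sum_(x : X) \sum_(y : Y) W x y * Z x w y w.

(* eps^NS(M, W): optimal error over NS codes (the minimum of this LP,
   expressed as the infimum) *)
Definition eps_NS (X Y : finType) (M : nat) (W : X -> Y -> R) : R :=
  inf [set e | exists Z : X -> 'I_M -> Y -> 'I_M -> R, is_NS_code Z /\ e = NS_error W Z].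

Definition neg_log_rate (n : nat) (e : R) : \bar R :=
  if e == 0 then +oo%E else (- ln e / n%:R)%:E.

End Defs.
Arguments chan_pow {R X Y} W n _ _.
Arguments eps_NS {R X Y} M W.
Arguments neg_log_rate {R} n e.

(* Main.v *)
Require Import Defs.
From HB Require Import structures.
From mathcomp Require Import all_boot all_order all_algebra.
From mathcomp Require Import all_classical all_reals all_analysis.
From mathcomp Require Import lra.
Import Order.TTheory GRing.Theory Num.Theory.
Local Open Scope ring_scope.

(** Averaging a non-signalling code over the messages leaves a distribution p
    on inputs and weights 0 <= B(x, y) <= p(x) with sum_x B(x, y) = 1 - 1/M, and
    the error is sum_(x, y) W(y|x) B(x, y); conversely every such pair comes from
    a code.  Achievability takes p = P^n and B supported on the inputs whose
    log-likelihood given y concentrates at or below its mean, so that the error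
    is about (sum_y prod_x W(y|x)^P(x))^n; the inner minimum over Q_Y is minus
    the logarithm of this partition function, attained at its Gibbs
    distribution.  For the converse a Gibbs distribution Q of a nearly optimal P
    satisfies D(Q||W_x) <= U + o(1) for every x; changing measure from W^n to
    Q^n then costs at most exp(n (U + o(1))) outside a set of small Q^n-measure,
    whereas B has Q^n-weight 1 - 1/M >= 1/2. *)

(** * Exponential estimates and concentration for product distributions *)

(** Inverting [1 - u <= expR (- u)] gives [expR u <= (1 - u)^-1], and [(1 - u) * (1 + u + 2 * u ^+
    2) = 1 + u ^+ 2 * (1 - 2 * u)] is at least 1 for [u <= 1/2]. *)
Lemma expR_le_quadratic {R : realType} (u : R) :
  `|u| <= 2^-1 -> expR u <= 1 + u + 2 * u ^+ 2.
Proof.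
rewrite ler_norml => /andP[u1 u2].
have h : 1 - u <= expR (- u) by exact: expR_ge1Dx.
have p : 0 < 1 - u by lra.
rewrite -[u in expR u]opprK expRN.
apply: (@le_trans _ _ (1 - u)^-1); first by rewrite lef_pV2 // posrE expR_gt0.
rewrite -[leLHS]mul1r ler_pdivrMr //.
have : 0 <= u ^+ 2 * (1 - 2 * u) by rewrite mulr_ge0 ?sqr_ge0 //; lra.
rewrite !expr2; nra.
Qed.

Lemma expRN_eventually_le {R : realType} (c e : R) : 0 < c -> 0 < e ->
  exists N, forall n, (N <= n)%N -> expR (- (c * n%:R)) <= e.
Proof.
move=> c0 e0; exists (Num.truncn (e^-1 / c)).+1 => n Nn.
have hn : e^-1 / c < n%:R.
  by apply: (lt_le_trans (truncnS_gt _)); rewrite ler_nat.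
rewrite expRN -[e]invrK lef_pV2 ?posrE ?expR_gt0 ?invr_gt0 //.
apply: le_trans (expR_ge1Dx _).
by rewrite mulrC; move: hn; rewrite ltr_pdivrMr // => /ltW h; lra.
Qed.

Lemma prod_ffun_is_dist {R : realType} {T : finType} n (P : 'I_n -> T -> R) :
  (forall i, is_dist (P i)) ->
  is_dist (fun t : {ffun 'I_n -> T} => \prod_i P i (t i)).
Proof.
move=> Pd; split=> [t|]; first by apply: prodr_ge0 => i _; exact: (Pd i).1.
by rewrite -(bigA_distr_bigA P) big1 // => i _; exact: (Pd i).2.
Qed.

Lemma family_norm_bounded {R : realType} {A T : finType} (h : A -> T -> R) :
  exists2 C, 0 < C & forall a t, `|h a t| <= C.
Proof.
exists (1 + \sum_a \sum_t `|h a t|).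
  by rewrite ltr_wpDr // sumr_ge0 // => a _; rewrite sumr_ge0.
move=> a t; rewrite (bigD1 a) //= (bigD1 t) //=.
set S1 := \sum_(i | i != t) _; set S2 := \sum_(i | i != a) _.
have S1_ge0 : 0 <= S1 by exact: sumr_ge0.
have S2_ge0 : 0 <= S2 by apply: sumr_ge0 => b _; exact: sumr_ge0.
lra.
Qed.

(* Markov's inequality for the moment generating function, whose value at a
   small parameter is at most 1 + O(s^2) because the means are nonpositive. *)
Lemma chernoff_family {R : realType} {A T : finType} (P : T -> R)
    (h : A -> T -> R) (d : R) :
  is_dist P -> (forall a, \sum_t P t * h a t <= 0) -> 0 < d ->
  exists2 c, 0 < c & forall n (a : 'I_n -> A),
    \sum_(t : {ffun 'I_n -> T} | d * n%:R < \sum_i h (a i) (t i))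
       \prod_i P (t i) <= expR (- (c * n%:R)).
Proof.
move=> [P0 P1] h0 d0; have [C C0 hC] := family_norm_bounded h.
(* The two summands of the denominator serve two needs: [s * C <= 1/2] for the quadratic bound, and
   a second-order term of at most half the gain [s * d]. *)
pose s := d / (4 * C ^+ 2 + 2 * C * d).
have D0 : 0 < 4 * C ^+ 2 + 2 * C * d.
  have := mulr_gt0 C0 C0; have := mulr_gt0 C0 d0; rewrite expr2; lra.
have s0 : 0 < s by rewrite divr_gt0.
have sE : s * (4 * C ^+ 2 + 2 * C * d) = d by rewrite /s mulfVK // gt_eqF.
have sC : s * C <= 2^-1.
  rewrite -(ler_pM2r d0); move: sE; rewrite expr2.
  have := mulr_gt0 s0 (mulr_gt0 C0 C0); lra.
have sC2 : 2 * (s ^+ 2 * C ^+ 2) <= s * d / 2.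
  have := mulr_gt0 s0 (mulr_gt0 s0 (mulr_gt0 C0 d0)).
  rewrite -[X in s * X / 2]sE !expr2; lra.
exists (s * d / 2); first by have := mulr_gt0 s0 d0; lra.
move=> n a.
apply: (@le_trans _ _ (\sum_(t : {ffun 'I_n -> T})
    \prod_i (P (t i) * expR (s * (h (a i) (t i) - d))))).
  rewrite big_mkcond; apply: ler_sum => t _; case: ifPn => ht; last first.
    by apply: prodr_ge0 => i _; rewrite mulr_ge0 ?expR_ge0.
  rewrite big_split /= ler_peMr ?prodr_ge0 //.
  rewrite -expR_sum -expR0 ler_expR -mulr_sumr mulr_ge0 ?ltW //.
  by rewrite sumrB sumr_const card_ord -mulr_natr subr_gt0.
rewrite -(bigA_distr_bigA (fun i t => P t * expR (s * (h (a i) t - d)))).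
rewrite -mulNr expRM_natr.
apply: (@le_trans _ _ (\prod_(i < n) expR (- (s * d / 2)))); last first.
  by rewrite prodr_const card_ord.
apply: ler_prod => i _; apply/andP; split.
  by apply: sumr_ge0 => t _; rewrite mulr_ge0 ?expR_ge0.
apply: (@le_trans _ _ (expR (- (s * d)) *
    \sum_t (P t + s * (P t * h (a i) t) + P t * (2 * (s ^+ 2 * C ^+ 2))))).
  rewrite mulr_sumr; apply: ler_sum => t _.
  rewrite mulrBr addrC expRD mulrCA ler_wpM2l ?expR_ge0 //.
  have b : `|s * h (a i) t| <= s * C.
    by rewrite normrM gtr0_norm // ler_wpM2l // ltW.
  rewrite [s * (P t * _)]mulrCA -[X in X + _ + _]mulr1 -!mulrDr ler_wpM2l //.
  apply: le_trans (expR_le_quadratic _ (le_trans b sC)) _.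
  rewrite lerD2l ler_wpM2l // -exprMn -real_normK ?num_real //.
  by rewrite ler_sqr // nnegrE ?normr_ge0 // mulr_ge0 // ltW.
rewrite !big_split /= -mulr_sumr -mulr_suml P1 mul1r.
rewrite (_ : - (s * d / 2) = - (s * d) + s * d / 2); last by lra.
rewrite expRD ler_wpM2l ?expR_ge0 //; apply: le_trans (expR_ge1Dx _).
have := mulr_ge0_le0 (ltW s0) (h0 (a i)); lra.
Qed.

(** * Eventual bounds on a limit inferior *)

Lemma limn_einf_ge {R : realType} (u : (\bar R)^nat) (l : \bar R) (N : nat) :
  (forall n, (N <= n)%N -> l <= u n)%E -> (l <= limn_einf u)%E.
Proof.
move=> h; rewrite limn_einf_lim (cvg_lim _ (@cvg_einfs_sup _ u)) //.
apply: (@le_trans _ _ (einfs u N)); last by apply: ereal_sup_ubound; exists N.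
by apply: le_ereal_inf_tmp => _ [n /= Nn <-]; exact: h.
Qed.

Lemma limn_einf_le {R : realType} (u : (\bar R)^nat) (l : \bar R) (N : nat) :
  (forall n, (N <= n)%N -> u n <= l)%E -> (limn_einf u <= l)%E.
Proof.
move=> h; rewrite limn_einf_lim (cvg_lim _ (@cvg_einfs_sup _ u)) //.
apply: ge_ereal_sup => _ [m _ <-].
apply: ge_ereal_inf; exists (u (maxn m N)); last by apply: h; rewrite leq_maxr.
by exists (maxn m N) => //=; rewrite leq_maxl.
Qed.

(** * Non-signalling codes as error weights *)

(* [B x y] is the joint weight of input [x] and a wrong guess when the output
   is [y], after averaging over the messages. *)
Definition is_error_weight {R : realType} {X Y : finType} (M : nat)
    (p : X -> R) (B : X -> Y -> R) : Prop :=
  [/\ is_dist p, forall x y, 0 <= B x y <= p x &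
      forall y, \sum_x B x y = 1 - M%:R^-1].

(** Each no-signalling condition is used once: the input marginal is the same at every output, so
    [p] can be read off at [y0]; and the marginal of the guess is the same for every message, so the
    probabilities of guessing [w] when [w] was sent add up to 1 over [w]. *)
Lemma NS_code_error_weight {R : realType} {X Y : finType} (M : nat)
    (W : X -> Y -> R) (Z : X -> 'I_M -> Y -> 'I_M -> R) (y0 : Y) :
  is_channel W -> (0 < M)%N -> is_NS_code Z ->
  exists p B, is_error_weight M p B /\
    NS_error W Z = \sum_x \sum_y W x y * B x y.
Proof.
move=> chW M0 [Z0 Z1 Zw Zy].
have MR : (0 : R) < M%:R by rewrite ltr0n.
have MV : M%:R^-1 * M%:R = 1 :> R by rewrite mulVf // gt_eqF.
pose p x := M%:R^-1 * \sum_w \sum_wh Z x wh y0 w.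
pose B x y := p x - M%:R^-1 * \sum_w Z x w y w.
have p1 : \sum_x p x = 1.
  rewrite -mulr_sumr exchange_big /= (eq_bigr (fun=> 1)) => [|w _]; last exact: Z1.
  by rewrite sumr_const card_ord.
exists p, B; split; first split.
- split=> // x; rewrite mulr_ge0 ?invr_ge0 ?ler0n //.
  by apply: sumr_ge0 => w _; exact: sumr_ge0.
- move=> x y; rewrite /B subr_ge0 gerBl mulr_ge0 ?invr_ge0 ?ler0n ?sumr_ge0 //.
  rewrite andbT ler_wpM2l ?invr_ge0 ?ler0n //; apply: ler_sum => w _.
  by rewrite (Zy x y0 y w) (bigD1 w) //= lerDl sumr_ge0.
- move=> y; rewrite /B sumrB p1 -mulr_sumr exchange_big /=.
  rewrite (eq_bigr (fun w => \sum_x Z x w y (Ordinal M0))) => [|w _]; last exact: Zw.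
  by rewrite exchange_big Z1 mulr1.
rewrite /NS_error /B.
transitivity (\sum_x \sum_y (W x y * p x - W x y * (M%:R^-1 * \sum_w Z x w y w))).
  under [RHS]eq_bigr do rewrite sumrB.
  rewrite [RHS]sumrB; congr (_ - _).
    rewrite -p1; apply: eq_bigr => x _.
    by rewrite -mulr_suml (chW x).2 mul1r.
  rewrite mulr_sumr; under eq_bigr do rewrite mulr_sumr.
  rewrite exchange_big /=.
  apply: eq_bigr => x _; under eq_bigr do rewrite mulr_sumr.
  rewrite exchange_big /=; apply: eq_bigr => y _.
  by rewrite !mulr_sumr; apply: eq_bigr => w _; rewrite mulrCA.
by apply: eq_bigr => x _; apply: eq_bigr => y _; rewrite mulrBr.
Qed.

Lemma error_weight_NS_code {R : realType} {X Y : finType} (M : nat)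
    (W : X -> Y -> R) (p : X -> R) (B : X -> Y -> R) :
  is_channel W -> (2 <= M)%N -> is_error_weight M p B ->
  exists2 Z : X -> 'I_M -> Y -> 'I_M -> R, is_NS_code Z &
    NS_error W Z = \sum_x \sum_y W x y * B x y.
Proof.
move=> chW M2 [[p0 p1] Bp B1].
have M1R : (0 : R) < M%:R - 1 by rewrite subr_gt0 ltr1n.
have MR : (0 : R) < M%:R by rewrite ltr0n; exact: ltnW.
(* The error weight is spread evenly over the [M - 1] wrong guesses, which makes the guess uniform
   whatever the message. *)
pose Z x (wh : 'I_M) y (w : 'I_M) :=
  if wh == w then p x - B x y else B x y / (M%:R - 1).
have Zsum x y w : \sum_wh Z x wh y w = p x.
  rewrite (bigD1 w) //= /Z eqxx (eq_bigr (fun=> B x y / (M%:R - 1))); last first.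
    by move=> i /negbTE ->.
  rewrite sumr_const cardC1 card_ord -[_ *+ M.-1]mulr_natr -subn1 natrB ?(ltnW M2) //.
  by rewrite mulfVK ?gt_eqF // subrK.
have Zsumx wh y w : \sum_x Z x wh y w = M%:R^-1.
  rewrite /Z; case: eqP => _; first by rewrite sumrB p1 B1; lra.
  rewrite -mulr_suml B1; apply: (mulIf (lt0r_neq0 M1R)).
  by rewrite mulfVK ?gt_eqF // mulrBr mulVf ?gt_eqF // mulr1.
exists Z.
  split=> [x wh y w|y w|wh y w w'|x y y' w]; rewrite ?Zsumx ?Zsum //.
    have /andP[h1 h2] := Bp x y; rewrite /Z; case: eqP => _; first by rewrite subr_ge0.
    by rewrite divr_ge0 // ltW.
  by rewrite -[RHS]p1; apply: eq_bigr => x _; exact: Zsum.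
rewrite /NS_error.
rewrite (eq_bigr (fun=> \sum_x \sum_y W x y * (p x - B x y))); last first.
  by move=> w _; do 2![apply: eq_bigr => ? _]; rewrite /Z eqxx.
rewrite sumr_const card_ord -[X in _^-1 * X]mulr_natl mulKf ?gt_eqF //.
apply/eqP; rewrite subr_eq -big_split /= -[X in X == _]p1; apply/eqP/eq_bigr => x _.
rewrite -big_split /= (eq_bigr (fun y => W x y * p x)) => [|y _].
  by rewrite -mulr_suml (chW x).2 mul1r.
by rewrite -mulrDr addrC subrK.
Qed.

Lemma NS_error_ge0 {R : realType} {X Y : finType} (M : nat)
    (W : X -> Y -> R) (Z : X -> 'I_M -> Y -> 'I_M -> R) (y0 : Y) :
  is_channel W -> (0 < M)%N -> is_NS_code Z -> 0 <= NS_error W Z.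
Proof.
move=> chW M0 /(NS_code_error_weight _ _ _ y0 chW M0)[p [B [[_ Bp _] ->]]].
apply: sumr_ge0 => x _; apply: sumr_ge0 => y _.
by have /andP[B0 _] := Bp x y; rewrite mulr_ge0 // (chW x).1.
Qed.

Lemma eps_NS_le {R : realType} {X Y : finType} (M : nat) (W : X -> Y -> R)
    (y0 : Y) (p : X -> R) (B : X -> Y -> R) :
  is_channel W -> (2 <= M)%N -> is_error_weight M p B ->
  eps_NS M W <= \sum_x \sum_y W x y * B x y.
Proof.
move=> chW M2 /(error_weight_NS_code _ _ _ _ chW M2)[Z hZ <-].
apply: ge_inf; last by exists Z.
exists 0 => _ [Z' [hZ' ->]].
exact: (NS_error_ge0 _ _ _ y0 chW (ltnW M2)).
Qed.

Lemma eps_NS_ge {R : realType} {X Y : finType} (M : nat) (W : X -> Y -> R)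
    (x0 : X) (y0 : Y) (c : R) :
  is_channel W -> (2 <= M)%N ->
  (forall p B, is_error_weight M p B -> c <= \sum_x \sum_y W x y * B x y) ->
  c <= eps_NS M W.
Proof.
move=> chW M2 h; apply: lb_le_inf; last first.
  move=> _ [Z [hZ ->]].
  by have [p [B [hB ->]]] := NS_code_error_weight _ _ _ y0 chW (ltnW M2) hZ; exact: (h _ _ hB).
have M1 : M%:R^-1 <= 1 :> R.
  by rewrite invf_le1 ?ler1n ?ltr0n (ltnW M2).
have M0 : 0 <= M%:R^-1 :> R by rewrite invr_ge0.
(* A lower bound passes to [inf] only over a nonempty set; the constant input [x0] with a blind
   uniform guess supplies a code. *)
pose p x : R := (x == x0)%:R; pose B x (y : Y) := p x * (1 - M%:R^-1).
have p1 : \sum_x p x = 1.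
  by rewrite (bigD1 x0) //= big1 ?addr0 /p ?eqxx // => x /negbTE ->.
have hB : is_error_weight M p B.
  split=> [|x y|y]; first by split=> // x; rewrite ler0n.
  - rewrite /B mulr_ge0 ?ler0n ?subr_ge0 //= ler_piMr ?ler0n //; lra.
  - by rewrite -mulr_suml p1 mul1r.
by have [Z hZ _] := error_weight_NS_code _ _ _ _ chW M2 hB; exists (NS_error W Z), Z.
Qed.

(** * Exponential bounds on the error over the n-fold channel *)

Lemma chan_pow_is_channel {R : realType} {X Y : finType} (W : X -> Y -> R) n :
  is_channel W -> is_channel (chan_pow W n).
Proof. by move=> chW x; exact: (prod_ffun_is_dist _ (fun i => W (x i))). Qed.

(* With i.i.d. inputs, by concentration almost every input sequence satisfies
   W^n(y|x) <= exp(sum_i L(y_i) + d n), where L(y) = sum_x P(x) ell(x, y);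
   the weight B is carried by these sequences. *)
Lemma eps_NS_pow_le {R : realType} {X Y : finType} (y0 : Y) (W : X -> Y -> R)
    (M : nat) (P : X -> R) (ell : X -> Y -> R) (d : R) :
  is_channel W -> (2 <= M)%N -> is_dist P ->
  (forall x y, W x y <= expR (ell x y)) -> 0 < d ->
  exists N, forall n, (N <= n)%N ->
    eps_NS M (chan_pow W n) <= (expR d * \sum_y expR (\sum_x P x * ell x y)) ^+ n.
Proof.
move=> chW M2 Pd Well d0.
pose L y := \sum_x P x * ell x y.
pose h y x := ell x y - L y.
have h0 y : \sum_x P x * h y x <= 0.
  rewrite /h; under eq_bigr do rewrite mulrBr.
  by rewrite sumrB -mulr_suml Pd.2 mul1r subrr.
have [c c0 hc] := chernoff_family P h d Pd h0 d0.
have M2R : (2 : R) <= M%:R by rewrite ler_nat.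
have MV0 : 0 < M%:R^-1 :> R by rewrite invr_gt0; lra.
have MV1 : M%:R^-1 <= 2^-1 :> R by rewrite lef_pV2 // posrE; lra.
have [N hN] := expRN_eventually_le c _ c0 MV0.
exists N => n Nn.
pose p (x : {ffun 'I_n -> X}) := \prod_i P (x i).
have pd : is_dist p by apply: (prod_ffun_is_dist _ (fun=> P)).
pose bad (x : {ffun 'I_n -> X}) (y : {ffun 'I_n -> Y}) :=
  d * n%:R < \sum_i h (y i) (x i).
pose S y := \sum_(x | ~~ bad x y) p x.
have S_ge y : 1 - M%:R^-1 <= S y.
  have := pd.2; rewrite (bigID (bad^~ y)) /= -/(S y).
  have : \sum_(x | bad x y) p x <= M%:R^-1 by exact: le_trans (hc n y) (hN n Nn).
  lra.
have S_gt0 y : 0 < S y by apply: lt_le_trans (S_ge y); lra.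
(* The factor restores the column sums to [1 - 1/M] exactly; it is at most 1 by [S_ge], whence
   [B <= p]. *)
pose B x y := if bad x y then 0 else p x * ((1 - M%:R^-1) / S y).
have B0 x y : 0 <= B x y.
  rewrite /B; case: ifP => // _; rewrite mulr_ge0 ?pd.1 // divr_ge0 ?(ltW (S_gt0 _)) //; lra.
have B1 y : \sum_x B x y = 1 - M%:R^-1.
  rewrite (bigID (bad^~ y)) /= big1 ?add0r; last by move=> x; rewrite /B => ->.
  rewrite (eq_bigr (fun x => p x * ((1 - M%:R^-1) / S y))); last first.
    by move=> x /negbTE; rewrite /B => ->.
  by rewrite -mulr_suml mulrC mulfVK // gt_eqF.
have hB : is_error_weight M p B.
  split=> // x y; rewrite B0 /= /B; case: ifP => _; first exact: pd.1.
  by rewrite ler_piMr ?pd.1 // ler_pdivrMr // mul1r.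
apply: le_trans (eps_NS_le _ _ [ffun=> y0] _ _ (chan_pow_is_channel _ n chW) M2 hB) _.
pose g (y : {ffun 'I_n -> Y}) := \prod_i (expR d * expR (L (y i))).
have g0 y : 0 <= g y by apply: prodr_ge0 => i _; rewrite mulr_ge0 ?expR_ge0.
apply: (@le_trans _ _ (\sum_x \sum_y g y * B x y)).
  apply: ler_sum => x _; apply: ler_sum => y _.
  rewrite /B; case: ifPn => hb; first by rewrite !mulr0.
  apply: ler_wpM2r; first by have := B0 x y; rewrite /B (negbTE hb).
  rewrite /g big_split /= prodr_const card_ord -expRM_natr -expR_sum -expRD.
  apply: (@le_trans _ _ (\prod_i expR (ell (x i) (y i)))).
    by apply: ler_prod => i _; rewrite (chW _).1 Well.
  rewrite -expR_sum ler_expR; move: hb.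
  rewrite /bad -leNgt sumrB; lra.
rewrite exchange_big /=.
apply: (@le_trans _ _ (\sum_y g y)).
  apply: ler_sum => y _; rewrite -mulr_sumr B1 ler_piMr //; lra.
rewrite /g -(bigA_distr_bigA (fun i y => expR d * expR (L y))) prodr_const card_ord.
by rewrite -mulr_sumr.
Qed.

(* Change of measure from W^n to Q^n: the likelihood ratio exceeds
   exp(n(k + d)) only with vanishing Q^n-probability, uniformly in the input. *)
Lemma eps_NS_pow_ge {R : realType} {X Y : finType} (x0 : X) (y0 : Y)
    (W : X -> Y -> R) (M : nat) (Q : Y -> R) (k d : R) :
  is_channel W -> (2 <= M)%N -> is_dist Q ->
  (forall x y, Q y != 0 -> W x y != 0) ->
  (forall x, \sum_y Q y * (ln (Q y) - ln (W x y)) <= k) -> 0 < d ->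
  exists N, forall n, (N <= n)%N ->
    expR (- ((k + d) * n%:R)) <= eps_NS M (chan_pow W n).
Proof.
move=> chW M2 Qd QW Qk d0; have d20 : 0 < d / 2 by lra.
pose h x y := ln (Q y) - ln (W x y) - k.
have h0 x : \sum_y Q y * h x y <= 0.
  rewrite /h; under eq_bigr do rewrite mulrBr.
  by rewrite sumrB -mulr_suml Qd.2 mul1r subr_le0.
have [c c0 hc] := chernoff_family Q h _ Qd h0 d20.
(* Of the weight [1 - 1/M >= 1/2], bad pairs take at most 1/4; the remaining 1/4 dominates
   [expR (- (d / 2 * n))] for large [n]. *)
have q0 : 0 < 4^-1 :> R by rewrite invr_gt0.
have [N1 hN1] := expRN_eventually_le c _ c0 q0.
have [N2 hN2] := expRN_eventually_le _ _ d20 q0.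
have M2R : (2 : R) <= M%:R by rewrite ler_nat.
have MV1 : M%:R^-1 <= 2^-1 :> R by rewrite lef_pV2 // posrE; lra.
exists (maxn N1 N2) => n; rewrite geq_max => /andP[Nn1 Nn2].
apply: (eps_NS_ge _ _ [ffun=> x0] [ffun=> y0] _ (chan_pow_is_channel _ n chW) M2).
move=> p B [pd Bp B1].
pose q (y : {ffun 'I_n -> Y}) := \prod_i Q (y i).
have qd : is_dist q by apply: (prod_ffun_is_dist _ (fun=> Q)).
pose bad (x : {ffun 'I_n -> X}) (y : {ffun 'I_n -> Y}) :=
  d / 2 * n%:R < \sum_i h (x i) (y i).
pose e := expR (- ((k + d / 2) * n%:R)).
have e0 : 0 <= e := expR_ge0 _.
have Wq x y : ~~ bad x y -> e * q y <= chan_pow W n x y.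
  (* Zeros of [Q] are split off since [ln 0] is only a default value; there [q y = 0]. *)
  have [/existsP[i /eqP Qi0]|] := boolP [exists i, Q (y i) == 0].
    move=> _; rewrite /q (bigD1 i) //= Qi0 mul0r mulr0.
    by apply: prodr_ge0 => j _; exact: (chW _).1.
  rewrite negb_exists => /forallP Qn0.
  have -> : q y = expR (\sum_i ln (Q (y i))).
    by rewrite expR_sum; apply: eq_bigr => i _; rewrite lnK // posrE lt0r Qn0 Qd.1.
  have -> : chan_pow W n x y = expR (\sum_i ln (W (x i) (y i))).
    rewrite expR_sum; apply: eq_bigr => i _; rewrite lnK // posrE lt0r.
    by rewrite QW // (chW _).1.
  rewrite -expRD ler_expR /bad -leNgt !sumrB sumr_const card_ord -[k *+ n]mulr_natr.
  lra.
(* On good pairs this is [Wq]; on bad pairs the new summand is [e * q y * (B x y - p x) <= 0]. *)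
apply: (@le_trans _ _ (\sum_x \sum_y
    e * (q y * B x y - (if bad x y then q y else 0) * p x))); last first.
  apply: ler_sum => x _; apply: ler_sum => y _.
  have /andP[B0 Ble] := Bp x y; case: ifPn => hb.
    apply: (@le_trans _ _ 0).
      by rewrite mulr_ge0_le0 // -mulrBr mulr_ge0_le0 ?qd.1 // subr_le0.
    by rewrite mulr_ge0 // (chan_pow_is_channel _ n chW x).1.
  by rewrite mul0r subr0 mulrA ler_wpM2r // Wq.
have -> : \sum_x \sum_y e * (q y * B x y - (if bad x y then q y else 0) * p x) =
    e * (1 - M%:R^-1 - \sum_x (\sum_(y | bad x y) q y) * p x).
  under eq_bigr do rewrite -mulr_sumr sumrB.
  rewrite -mulr_sumr sumrB; congr (_ * (_ - _)).
    rewrite exchange_big /= (eq_bigr (fun y => q y * (1 - M%:R^-1))).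
      by rewrite -mulr_suml qd.2 mul1r.
    by move=> y _; rewrite -mulr_sumr B1.
  by apply: eq_bigr => x _; rewrite -mulr_suml -big_mkcond.
have hs : \sum_x (\sum_(y | bad x y) q y) * p x <= 4^-1.
  apply: (@le_trans _ _ (\sum_x 4^-1 * p x)).
    apply: ler_sum => x _; rewrite ler_wpM2r ?pd.1 //.
    exact: le_trans (hc n x) (hN1 n Nn1).
  by rewrite -mulr_sumr pd.2 mulr1.
have -> : - ((k + d) * n%:R) = - ((k + d / 2) * n%:R) + - (d / 2 * n%:R) by lra.
rewrite expRD ler_wpM2l //; apply: le_trans (hN2 n Nn2) _; lra.
Qed.

(** * Comparisons in the extended reals and rates *)

Lemma lee_of_lt_EFin {R : realType} (x y : \bar R) :
  (forall r : R, r%:E < x -> r%:E <= y)%E -> (x <= y)%E.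
Proof.
move: x y => [x| |] [y| |] h; rewrite ?leey ?leNye //.
- rewrite leNgt; apply/negP; rewrite lte_fin => yx.
  have := h ((x + y) / 2); rewrite lte_fin lee_fin => /(_ ltac:(lra)); lra.
- by have := h (x - 1); rewrite lte_fin => /(_ ltac:(lra)).
- exfalso; have := h (y + 1) (ltry _); rewrite lee_fin; lra.
- by have := h 0 (ltry _).
Qed.

Lemma lee_of_gt_EFin {R : realType} (x y : \bar R) :
  (forall s d : R, x < s%:E -> (0 < d)%R -> y <= (s + d)%R%:E)%E -> (y <= x)%E.
Proof.
move: x y => [x| |] [y| |] h; rewrite ?leey ?leNye //.
- rewrite leNgt; apply/negP; rewrite lte_fin => xy.
  have := h (x + (y - x) / 4) ((y - x) / 4).
  rewrite lte_fin lee_fin => /(_ ltac:(lra) ltac:(lra)); lra.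
- by have := h (x + 1) 1; rewrite lte_fin => /(_ ltac:(lra) ltac:(lra)).
- exfalso; have := h (y - 2) 1 (ltNyr _) ltr01; rewrite lee_fin; lra.
- by have := h 0 1 (ltNyr _) ltr01.
Qed.

Lemma neg_log_rate_le {R : realType} n (e r : R) : (0 < n)%N ->
  expR (- (r * n%:R)) <= e -> (neg_log_rate n e <= r%:E)%E.
Proof.
move=> n0 he; have e0 : 0 < e := lt_le_trans (expR_gt0 _) he.
rewrite /neg_log_rate gt_eqF // lee_fin ler_pdivrMr ?ltr0n //.
by move: he; rewrite -{1}[e]lnK ?posrE // ler_expR; lra.
Qed.

Lemma neg_log_rate_ge {R : realType} n (e r : R) : (0 < n)%N -> 0 <= e ->
  e <= expR (- (r * n%:R)) -> (r%:E <= neg_log_rate n e)%E.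
Proof.
move=> n0 e0 he; rewrite /neg_log_rate; case: eqP => [|/eqP en0]; first by rewrite leey.
have e_gt0 : 0 < e by rewrite lt0r en0.
rewrite lee_fin ler_pdivlMr ?ltr0n //.
by move: he; rewrite -{1}[e]lnK ?posrE // ler_expR; lra.
Qed.

(** * Variational formula for the inner minimum *)

(** This is the nonnegativity of the divergence of [Q] from the Gibbs distribution [F] on [D],
    obtained termwise from [1 + x <= expR x]. *)
Lemma gibbs_inequality {R : realType} {T : finType} (D : pred T) (Q L : T -> R) :
  is_dist Q -> (forall t, Q t != 0 -> D t) ->
  expR (- \sum_t Q t * (ln (Q t) - L t)) <= \sum_(t | D t) expR (L t).
Proof.
move=> [Q0 Q1] QD; set Z := \sum_(t | D t) _.
have Z0 : 0 < Z.
  have [t Qt] : exists t, Q t != 0.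
    apply/existsP; apply: contraTT (@oner_neq0 R) => /existsPn h.
    by rewrite negbK -Q1 big1 // => t _; apply/eqP; have := h t; rewrite negbK.
  rewrite /Z (bigD1 t) ?QD //= ltr_wpDr ?expR_gt0 //.
  by apply: sumr_ge0 => ? _; exact: expR_ge0.
rewrite -[leRHS]lnK ?posrE // ler_expR.
pose F t := if D t then expR (L t) / Z else 0.
have F1 : \sum_t F t = 1.
  by rewrite /F -big_mkcond -mulr_suml mulfV // gt_eqF.
suff : \sum_t (Q t - F t - Q t * ln Z) <= \sum_t Q t * (ln (Q t) - L t).
  by rewrite !sumrB -mulr_suml Q1 F1; lra.
apply: ler_sum => t _; have [Qt|Qt] := eqVneq (Q t) 0.
  rewrite Qt !mul0r subr0 sub0r oppr_le0 /F; case: ifP => // _.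
  by rewrite divr_ge0 ?expR_ge0 // ltW.
have Qp : 0 < Q t by rewrite lt0r Qt Q0.
rewrite /F (QD _ Qt).
have -> : expR (L t) / Z = Q t * expR (- (ln (Q t) - L t + ln Z)).
  by rewrite !opprD opprK !expRD !expRN !lnK ?posrE // !mulrA mulfV ?mul1r.
have := ler_wpM2l (ltW Qp) (expR_ge1Dx (- (ln (Q t) - L t + ln Z))).
lra.
Qed.

(** The factor [P x] cancels in the likelihood ratio, leaving a free energy in [Q] with exponents
    [sum_x P x * ln (W x y)]. *)
Lemma kl_joint_fin {R : realType} {X Y : finType} (W : X -> Y -> R)
    (P : X -> R) (Q : Y -> R) :
  is_channel W -> is_dist P -> is_dist Q ->
  (forall x y, P x != 0 -> Q y != 0 -> W x y != 0) ->
  kl (fun xy : X * Y => P xy.1 * Q xy.2) (fun xy => P xy.1 * W xy.1 xy.2) =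
  (\sum_y Q y * (ln (Q y) - \sum_x P x * ln (W x y)))%:E.
Proof.
move=> chW [P0 P1] [Q0 Q1] PQW; rewrite /kl.
rewrite (eq_bigr (fun xy : X * Y =>
    (P xy.1 * Q xy.2 * (ln (Q xy.2) - ln (W xy.1 xy.2)))%:E)).
  rewrite sumEFin; congr EFin.
  rewrite -(pair_bigA _ (fun x y => P x * Q y * (ln (Q y) - ln (W x y)))) /=.
  rewrite exchange_big /=; apply: eq_bigr => y _.
  rewrite -[ln (Q y) in RHS]mul1r -P1 mulr_suml -sumrB mulr_sumr.
  by apply: eq_bigr => x _; lra.
move=> [x y] _ /=; rewrite /kl_term.
have [->|Px] := eqVneq (P x) 0; first by rewrite !mul0r eqxx.
have [->|Qy] := eqVneq (Q y) 0; first by rewrite mulr0 eqxx !mul0r.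
have Wxy := PQW _ _ Px Qy.
rewrite !mulf_eq0 (negbTE Px) (negbTE Qy) (negbTE Wxy) /=.
rewrite -mulf_div divff // mul1r ln_div // posrE lt0r.
  by rewrite Qy Q0.
by rewrite Wxy (chW x).1.
Qed.

Lemma kl_eq_pinfty {R : realType} {T : finType} (P Q : T -> R) t :
  P t != 0 -> Q t = 0 -> kl P Q = +oo%E.
Proof.
move=> Pt Qt; apply/eqP; rewrite /kl esum_eqy.
  by apply/existsP; exists t; rewrite /kl_term (negbTE Pt) Qt !eqxx.
by move=> s _; rewrite /kl_term; case: ifP => // _; case: ifP.
Qed.

Lemma dist_support_ge {R : realType} {T : finType} (P : T -> R) :
  (forall t, 0 <= P t) -> exists2 m, 0 < m & forall t, P t != 0 -> m <= P t.
Proof.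
move=> P0; exists (\big[Num.min/1]_(t | P t != 0) P t).
  by apply: lt_bigmin => // t Pt; rewrite lt0r Pt P0.
by move=> t Pt; exact: bigmin_le_cond.
Qed.

Lemma channel_le1 {R : realType} {X Y : finType} (W : X -> Y -> R) x y :
  is_channel W -> W x y <= 1.
Proof.
move=> chW; have [W0 W1] := chW x; rewrite -W1 (bigD1 y) //= lerDl.
by apply: sumr_ge0 => z _; exact: W0.
Qed.

(* The zeros of W are replaced by exp(-K) with K large, which makes the
   exponents finite; outputs y with W(y|x) = 0 for some x in the support of P
   then contribute arbitrarily little. *)
Lemma zero_free_exponents {R : realType} {X Y : finType} (W : X -> Y -> R)
    (P : X -> R) (a : R) :
  is_channel W -> is_dist P ->
  \sum_(y | [forall x, (P x != 0) ==> (W x y != 0)])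
     expR (\sum_x P x * ln (W x y)) < a ->
  exists2 ell : X -> Y -> R, forall x y, W x y <= expR (ell x y) &
    \sum_y expR (\sum_x P x * ell x y) < a.
Proof.
move=> chW [P0 P1]; set good := fun y => [forall x, (P x != 0) ==> (W x y != 0)].
rewrite -/good; set Z := \sum_(y | _) _ => Za.
have [m m0 mP] := dist_support_ge P P0.
(* The slack [a - Z] is shared among the outputs, with one spare share to keep the inequality
   strict. An output outside [good] has some [x] with [W x y = 0] and [P x >= m], so its term is at
   most [expR (- (m * K))], hence at most one share. *)
have e0 : 0 < (a - Z) / #|Y|.+1%:R by rewrite divr_gt0 ?subr_gt0.
have [K hK] := expRN_eventually_le m _ m0 e0; have {hK} := hK K (leqnn K).
set e := _ / _ in e0 * => hK.
pose ell x y := if W x y == 0 then - K%:R else ln (W x y).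
have ell0 x y : ell x y <= 0.
  rewrite /ell; case: eqP => _; first by rewrite oppr_le0.
  exact/ln_le0/channel_le1.
exists ell.
  move=> x y; rewrite /ell; case: eqVneq => [->|W0]; first exact: expR_ge0.
  by rewrite lnK // posrE lt0r W0 (chW x).1.
rewrite (bigID good) /= (eq_bigr (fun y => expR (\sum_x P x * ln (W x y)))); last first.
  move=> y /forallP gy; congr expR; apply: eq_bigr => x _.
  have := gy x; rewrite /ell; have [->|_ /= /negbTE ->//] := eqVneq (P x) 0.
  by rewrite !mul0r.
rewrite -/Z -ltrBrDl.
apply: (@le_lt_trans _ _ (\sum_(y : Y) e)); last first.
  rewrite sumr_const -[_ *+ #|_|]mulr_natr /e.
  rewrite -[ltRHS](@divfK _ #|Y|.+1%:R) ?pnatr_eq0 // ltr_pM2l //.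
  by rewrite ltr_nat.
rewrite big_mkcond; apply: ler_sum => y _; case: ifPn => [|_]; last exact: ltW.
rewrite negb_forall => /existsP[x]; rewrite negb_imply negbK => /andP[Px /eqP Wxy].
apply: le_trans hK; rewrite ler_expR (bigD1 x) //= -[leRHS]addr0.
apply: lerD; last by apply: sumr_le0 => z _; rewrite mulr_ge0_le0.
by rewrite /ell Wxy eqxx mulrN lerN2 ler_wpM2r ?mP.
Qed.

Definition inf_kl_joint {R : realType} {X Y : finType} (W : X -> Y -> R)
    (P : X -> R) : \bar R :=
  ereal_inf [set v | exists QY : Y -> R, is_dist QY /\
    v = kl (fun xy : X * Y => P xy.1 * QY xy.2)
           (fun xy : X * Y => P xy.1 * W xy.1 xy.2)].

(** The Gibbs distribution on [good], taken as competitor, attains divergence [- ln Z]. An empty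
    [good] gives [Z = 0] and is handled apart. *)
Lemma lt_inf_kl_joint {R : realType} {X Y : finType} (W : X -> Y -> R)
    (P : X -> R) (r : R) :
  is_channel W -> is_dist P ->
  (r%:E < inf_kl_joint W P)%E ->
  \sum_(y | [forall x, (P x != 0) ==> (W x y != 0)])
     expR (\sum_x P x * ln (W x y)) < expR (- r).
Proof.
move=> chW Pd; set good := fun y => [forall x, (P x != 0) ==> (W x y != 0)].
rewrite -/good; set Z := \sum_(y | _) _ => hr.
have Zge0 : 0 <= Z by apply: sumr_ge0 => y _; exact: expR_ge0.
have [->|Zn0] := eqVneq Z 0; first exact: expR_gt0.
have Z0 : 0 < Z by rewrite lt0r Zn0.
pose L y := \sum_x P x * ln (W x y).
pose Q y := if good y then expR (L y) / Z else 0.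
have Q1 : \sum_y Q y = 1 by rewrite /Q -big_mkcond -mulr_suml mulfV.
have Qd : is_dist Q.
  by split=> // y; rewrite /Q; case: ifP => // _; rewrite divr_ge0 ?expR_ge0.
have QW x y : P x != 0 -> Q y != 0 -> W x y != 0.
  rewrite /Q; case: ifP => [/forallP/(_ x) /implyP h /h //|]; rewrite ?eqxx //.
have := lt_le_trans hr (ereal_inf_lbound (ex_intro _ Q (conj Qd erefl))).
rewrite (kl_joint_fin W P Q chW Pd Qd QW) lte_fin.
rewrite (eq_bigr (fun y => Q y * - ln Z)) => [|y _]; last first.
  rewrite /Q; case: ifP => _; last by rewrite !mul0r.
  by rewrite ln_div ?posrE ?expR_gt0 // expRK -/(L y) addrAC subrr add0r.
rewrite -mulr_suml Q1 mul1r => h.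
by rewrite -[ltLHS]lnK ?posrE // ltr_expR; lra.
Qed.

(** A competitor of finite divergence must live on outputs that every input can reach, as [P] has
    full support; there the Gibbs inequality applies. *)
Lemma inf_kl_joint_lt {R : realType} {X Y : finType} (W : X -> Y -> R)
    (P : X -> R) (s : R) :
  is_channel W -> is_dist P -> (forall x, 0 < P x) ->
  (inf_kl_joint W P < s%:E)%E ->
  expR (- s) <= \sum_(y | [forall x, W x y != 0]) expR (\sum_x P x * ln (W x y)).
Proof.
move=> chW Pd Pp /ereal_inf_lt[_ [Q [Qd ->]] hs].
have QW x y : P x != 0 -> Q y != 0 -> W x y != 0.
  move=> Px Qy; apply/eqP => Wxy; move: hs.
  by rewrite (kl_eq_pinfty _ _ (x, y)) //= ?mulf_neq0 // Wxy mulr0.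
move: hs; rewrite (kl_joint_fin W P Q chW Pd Qd QW) lte_fin => hs.
apply: le_trans (gibbs_inequality _ Q _ Qd _); first by rewrite ler_expR lerN2 ltW.
by move=> y Qy; apply/forallP => x; rewrite QW // gt_eqF.
Qed.

(* Q is the Gibbs distribution of a near-minimiser P of the partition function
   Z(P) = sum_y prod_x W(y|x)^P(x). Moving P slightly towards a point mass at x
   cannot decrease Z much below its infimum; since the derivative of log Z in
   this direction is -(D(Q||W_x) + log Z(P)), this bounds D(Q||W_x). *)
Lemma near_optimal_output {R : realType} {X Y : finType} (x0 : X)
    (W : X -> Y -> R) (u d : R) :
  0 < d ->
  (forall P : X -> R, is_dist P -> (forall x, 0 < P x) ->
    expR (- u) <= \sum_(y | [forall x, W x y != 0]) expR (\sum_x P x * ln (W x y))) ->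
  exists Q : Y -> R, [/\ is_dist Q, forall x y, Q y != 0 -> W x y != 0 &
    forall x, \sum_y Q y * (ln (Q y) - ln (W x y)) <= u + d].
Proof.
move=> d0 hu; pose good y := [forall x, W x y != 0].
pose L (P : X -> R) y := \sum_x P x * ln (W x y).
pose Z P := \sum_(y | good y) expR (L P y).
(* Full support keeps the set of outputs in [Z] the same for all [P]. The infimum need not be
   attained on this open domain, hence a near-minimiser. *)
pose E : set R := [set z | exists P, [/\ is_dist P, forall x, 0 < P x & z = Z P]]%classic.
have E_lb : lbound E (expR (- u)) by move=> _ [P [Pd Pp ->]]; exact: hu.
have E_inf : has_inf E.
  split; last by exists (expR (- u)).
  have X0 : (0 : R) < #|X|%:R by rewrite ltr0n; apply/card_gt0P; exists x0.
  exists (Z (fun=> #|X|%:R^-1)), (fun=> #|X|%:R^-1); split=> //.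
    split=> [x|]; first by rewrite invr_ge0 ltW.
    by rewrite sumr_const -[_ *+ #|_|]mulr_natr mulVf // gt_eqF.
  by move=> x; rewrite invr_gt0.
have m0 : 0 < inf E by apply: lt_le_trans (expR_gt0 (- u)) (lb_le_inf E_inf.1 E_lb).
have [K0 K00 hK0] := family_norm_bounded (fun x y => ln (W x y)).
pose K := 2 * K0; have Kp : 0 < K by rewrite mulr_gt0.
(* With [t = d / D] the first summand yields [t * K + t <= 1/2], the second
   [t * (1 + 2 * K ^+ 2) <= d]. *)
pose D := 2 * d * (1 + K) + (1 + 2 * K ^+ 2).
have K2 : 0 <= K ^+ 2 by rewrite sqr_ge0.
have dK := mulr_gt0 d0 Kp.
have Dp : 0 < D by rewrite /D; lra.
pose t := d / D; have t0 : 0 < t by rewrite divr_gt0.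
have tD : t * D = d by rewrite /t mulfVK // gt_eqF.
have td : t * (1 + 2 * K ^+ 2) <= d.
  have := mulr_gt0 t0 dK; have := mulr_gt0 t0 d0.
  move: tD; rewrite /D; lra.
have tK : t * K + t <= 2^-1.
  rewrite -(ler_pM2r d0).
  have := mulr_ge0 (ltW t0) K2; move: tD t0; rewrite /D; lra.
have tKp := mulr_gt0 t0 Kp.
have t1 : t < 1 by lra.
(* The relative gap [t ^+ 2] is of second order, so it still vanishes with [t] after the final
   division by [t]. *)
have [_ [P [Pd Pp ->]] ZP] := inf_adherent (mulr_gt0 (exprn_gt0 2 t0) m0) E_inf.
have Zge P' : is_dist P' -> (forall x, 0 < P' x) -> inf E <= Z P'.
  by move=> P'd P'p; apply: ge_inf; [exact: E_inf.2 | exists P'].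
have Z0 : 0 < Z P by apply: lt_le_trans m0 (Zge P Pd Pp).
pose Q y := if good y then expR (L P y) / Z P else 0.
have Q1 : \sum_y Q y = 1.
  by rewrite /Q -big_mkcond -mulr_suml mulfV // gt_eqF.
have Q0 y : 0 <= Q y.
  by rewrite /Q; case: ifP => // _; rewrite divr_ge0 ?expR_ge0 // ltW.
exists Q; split=> //.
  by move=> x y; rewrite /Q; case: ifP => [/forallP//|]; rewrite eqxx.
move=> x.
pose lam y := L P y - ln (W x y).
have lamK y : `|lam y| <= K.
  apply: le_trans (ler_normB _ _) _.
  rewrite /K mulr_natl mulr2n; apply: lerD; last exact: hK0.
  apply: le_trans (ler_norm_sum _ _ _) _.
  rewrite -[leRHS]mul1r -Pd.2 mulr_suml; apply: ler_sum => z _.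
  by rewrite normrM ger0_norm ?Pd.1 // ler_wpM2l ?Pd.1.
pose v := \sum_y Q y * lam y.
have -> : \sum_y Q y * (ln (Q y) - ln (W x y)) = v - ln (Z P).
  rewrite -[ln (Z P)]mul1r -Q1 mulr_suml -sumrB; apply: eq_bigr => y _.
  rewrite /lam /Q; case: ifP => _; last by rewrite !mul0r subr0.
  by rewrite ln_div ?posrE ?expR_gt0 // expRK; lra.
have lnZ : - ln (Z P) <= u.
  have := hu P Pd Pp; rewrite -/(Z P) -[X in _ <= X](@lnK _ (Z P)) ?posrE //.
  by rewrite ler_expR; lra.
pose Pt z := (1 - t) * P z + t * (z == x)%:R.
have Ptd : is_dist Pt.
  split=> [z|]; first by rewrite addr_ge0 // mulr_ge0 ?Pd.1 ?ler0n ?(ltW t0) // subr_ge0 ltW.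
  rewrite big_split /= -!mulr_sumr Pd.2 (bigD1 x) //= big1 ?eqxx ?mulr1n; first by lra.
  by move=> z /negbTE ->.
have Ptp z : 0 < Pt z.
  by apply: ltr_wpDr; [rewrite mulr_ge0 ?(ltW t0)|rewrite mulr_gt0 // subr_gt0].
have LPt y : L Pt y = L P y + - (t * lam y).
  have Dx : \sum_z (z == x)%:R * ln (W z y) = ln (W x y).
    rewrite (bigD1 x) //= eqxx mul1r big1 ?addr0 // => z /negbTE ->.
    by rewrite mul0r.
  transitivity (\sum_z ((1 - t) * (P z * ln (W z y)) + t * ((z == x)%:R * ln (W z y)))).
    by apply: eq_bigr => z _; rewrite /Pt; lra.
  by rewrite big_split /= -!mulr_sumr Dx -/(L P y) /lam; lra.
have ZPt : Z Pt <= Z P * (1 - t * v + 2 * (t * K) ^+ 2).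
  have -> : Z P * (1 - t * v + 2 * (t * K) ^+ 2) =
      Z P * \sum_y Q y * (1 - t * lam y + 2 * (t * K) ^+ 2).
    congr (_ * _); under [RHS]eq_bigr do rewrite mulrDr mulrBr mulr1 mulrCA.
    by rewrite big_split sumrB /= -mulr_sumr -mulr_suml Q1 mul1r.
  rewrite mulr_sumr /Z big_mkcond; apply: ler_sum => y _; rewrite /Q.
  case: ifP => _; last by rewrite mul0r mulr0.
  rewrite mulrA [Z P * _]mulrCA mulfV ?gt_eqF // mulr1 LPt expRD ler_wpM2l ?expR_ge0 //.
  have b : `|- (t * lam y)| <= t * K.
    by rewrite normrN normrM gtr0_norm // ler_wpM2l // ltW.
  apply: le_trans (expR_le_quadratic _ _) _; first by apply: le_trans b _; lra.
  rewrite lerD2l ler_wpM2l // -real_normK ?num_real //.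
  by rewrite ler_sqr // nnegrE ?normr_ge0 // ltW.
set a := 1 - t * v + _ in ZPt.
have t2 : 0 < t ^+ 2 by rewrite exprn_gt0.
have aZ : 1 <= (1 + t ^+ 2) * a.
  rewrite -(ler_pM2l Z0) mulr1.
  have h1 := ler_wpM2l (ltW t2) (le_trans (Zge Pt Ptd Ptp) ZPt).
  have h2 := le_trans (Zge Pt Ptd Ptp) ZPt; lra.
have a1 : 1 - t ^+ 2 <= a.
  rewrite leNgt; apply/negP => ha.
  have := mulr_gt0 t2 t2; have := ltr_pM2l (_ : 0 < 1 + t ^+ 2) a (1 - t ^+ 2).
  move=> /(_ ltac:(lra)); rewrite ha => ha'; lra.
have : t * v <= t * d.
  apply: (@le_trans _ _ (t * (t * (1 + 2 * K ^+ 2)))); last by rewrite ler_pM2l.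
  move: a1; rewrite /a !expr2; lra.
rewrite ler_pM2l //; lra.
Qed.

(** * Achievability, converse and conclusion *)

Lemma umlaut_le_rate {R : realType} {X Y : finType} (y0 : Y) (x0 : X)
    (W : X -> Y -> R) (M : nat) :
  is_channel W -> (2 <= M)%N ->
  (umlaut W <= limn_einf (fun n => neg_log_rate n (eps_NS M (chan_pow W n))))%E.
Proof.
move=> chW M2; apply: ge_ereal_sup => _ [P [Pd ->]].
apply: lee_of_lt_EFin => r /(lt_inf_kl_joint W P r chW Pd).
move=> /(zero_free_exponents W P _ chW Pd)[ell Well Zr].
set Z := \sum_y _ in Zr.
have Z0 : 0 < Z.
  rewrite /Z (bigD1 y0) //= ltr_wpDr ?expR_gt0 //.
  by apply: sumr_ge0 => y _; exact: expR_ge0.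
(* This gap is the concentration margin for which [expR d * Z] equals [expR (- r)] exactly. *)
have d0 : 0 < - r - ln Z.
  by move: Zr; rewrite -[ltLHS]lnK ?posrE // ltr_expR subr_gt0.
have [N hN] := eps_NS_pow_le y0 W M P ell _ chW M2 Pd Well d0.
(* The successor ensures [n > 0], so that dividing by [n] is meaningful. *)
apply: (limn_einf_ge _ _ N.+1) => n Nn.
have n0 : (0 < n)%N by exact: leq_ltn_trans Nn.
apply: neg_log_rate_ge => //.
  apply: (eps_NS_ge _ _ [ffun=> x0] [ffun=> y0] _ (chan_pow_is_channel _ n chW) M2).
  move=> p B [_ Bp _]; apply: sumr_ge0 => x _; apply: sumr_ge0 => y _.
  have /andP[B0 _] := Bp x y.
  by rewrite mulr_ge0 // (chan_pow_is_channel _ n chW x).1.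
apply: le_trans (hN n (ltnW Nn)) _.
rewrite -/Z -[X in _ * X]lnK ?posrE // -expRD subrK -expRM_natr.
by rewrite mulNr.
Qed.

Lemma rate_le_umlaut {R : realType} {X Y : finType} (x0 : X) (y0 : Y)
    (W : X -> Y -> R) (M : nat) :
  is_channel W -> (2 <= M)%N ->
  (limn_einf (fun n => neg_log_rate n (eps_NS M (chan_pow W n))) <= umlaut W)%E.
Proof.
move=> chW M2; apply: lee_of_gt_EFin => s d Us d0.
(* Half of the margin pays for the near-optimal [Q], half for the change of measure. *)
have d20 : 0 < d / 2 by lra.
have hs (P : X -> R) : is_dist P -> (forall x, 0 < P x) ->
    expR (- s) <= \sum_(y | [forall x, W x y != 0]) expR (\sum_x P x * ln (W x y)).
  move=> Pd Pp; apply: inf_kl_joint_lt => //; apply: le_lt_trans Us.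
  by apply: ereal_sup_ubound; exists P.
have [Q [Qd QW Qs]] := near_optimal_output x0 W s _ d20 hs.
have [N hN] := eps_NS_pow_ge x0 y0 W M Q _ _ chW M2 Qd QW Qs d20.
apply: (limn_einf_le _ _ N.+1) => n Nn.
apply: neg_log_rate_le; first exact: leq_ltn_trans Nn.
by have := hN n (ltnW Nn); rewrite (_ : s + d / 2 + d / 2 = s + d); last by lra.
Qed.

Theorem mainTheorem2 (R : realType) (X Y : finType) (x0 : X)
  (W : X -> Y -> R) (M : nat) :
  is_channel W -> (2 <= M)%N ->
  limn_einf (fun n : nat => neg_log_rate n (eps_NS M (chan_pow W n)))
  = umlaut W.
Proof.
move=> chW M2.
(* Over an empty [Y] the row of [x0] would sum to 0 instead of 1. *)
have [y0 _] : exists y : Y, true.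
  apply/existsP; apply: contraTT (@oner_neq0 R) => /existsPn Y0.
  by rewrite negbK -(chW x0).2 big1 // => y; have := Y0 y.
apply/eqP; rewrite eq_le umlaut_le_rate // andbT.
exact: rate_le_umlaut.
Qed.
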